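(* For every integer $k\ge3$, one has $B(k)\ge r_k$, where $$r_k=\begin{cases}\dfrac{k+\sqrt{k^2-2k}}{2}, & k\text{ even},\\[6pt] \dfrac{k+\sqrt{k^2-2k+2}}{2}, & k\text{ odd}.\end{cases}$$
   Context: All set families are finite families of distinct sets. A family is $w$-uniform if all its members have exactly $w$ elements (the ground set is an arbitrary finite set, not fixed). A $k$-sunflower is a collection of $k$ distinct sets $A_1,\dots,A_k$ for which there is a set $C$ (the core, possibly empty) with $A_i\cap A_j=C$ for all $i\ne j$. For $w\ge1$, $k\ge2$, $f(w,k)$ denotes the maximum size of a $w$-uniform family containing no $k$-sunflower (finite by the Erdős–Rado sunflower lemma). The exponential growth rate is $$B(k)=\lim_{w\to\infty} f(w,k)^{1/w}=\sup_{w\ge1} f(w,k)^{1/w}\in(0,\infty];$$ the limit exists in the extended reals and equals the supremum by Fekete's lemma, because $f(u+v,k)\ge f(u,k)f(v,k)$. *)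

(* Defs.v *)
From mathcomp Require Import all_boot all_order all_algebra.
From mathcomp Require Import all_classical all_reals all_analysis.

Set Implicit Arguments.
Unset Strict Implicit.
Unset Printing Implicit Defensive.

Import Order.TTheory GRing.Theory Num.Theory.

Local Open Scope ring_scope.

Definition uniform (T : finType) (w : nat) (F : {set {set T}}) : Prop :=
  {in F, forall A : {set T}, #|A| = w}.

Definition sunflower (T : finType) (k : nat) (S : {set {set T}}) : Prop :=
  #|S| = k /\
  exists C : {set T}, {in S &, forall A B : {set T}, A != B -> A :&: B = C}.

Definition sunflower_free (T : finType) (k : nat) (F : {set {set T}}) : Prop :=
  forall S : {set {set T}}, S \subset F -> ~ sunflower k S.

Definition sunflower_free_size (w k m : nat) : Prop :=
  exists (T : finType) (F : {set {set T}}),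
    [/\ uniform w F, sunflower_free k F & #|F| = m].

(* For k >= 2 the maximum exists by the Erdos-Rado sunflower lemma; the default
   value 0 is only used when there is no maximum. *)
Definition max_sunflower_free (w k : nat) : nat :=
  xget 0%N [set m : nat | sunflower_free_size w k m /\
    forall n : nat, sunflower_free_size w k n -> (n <= m)%N]%classic.

(* The limit is taken in the extended reals, where it exists for k >= 2 by
   Fekete's lemma. The term of index 0 is 1, since 0^-1 = 0. *)
Definition sunflower_growth (R : realType) (k : nat) : \bar R :=
  limn (fun w : nat =>
    (((max_sunflower_free w k)%:R : R) `^ (w%:R^-1))%:E).

Definition growth_bound (R : realType) (k : nat) : R :=
  if odd k then (k%:R + Num.sqrt (k%:R ^+ 2 - 2 * k%:R + 2)) / 2
  else (k%:R + Num.sqrt (k%:R ^+ 2 - 2 * k%:R)) / 2.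

(* Main.v *)
Require Import Defs.
From mathcomp Require Import all_boot all_order all_algebra.
From mathcomp Require Import all_classical all_reals all_analysis.
From mathcomp Require Import fintype finset zify ring lra.

Set Implicit Arguments.
Unset Strict Implicit.
Unset Printing Implicit Defensive.

(* Let n = k - 1 and m = n./2. Besides sunflower-free w-uniform families, of size
   a_w, consider those without n pairwise disjoint members, of size c_w. Given
   such a family F that is w-uniform and a sunflower-free (w-1)-uniform family G
   on another ground set, take n new points x with m disjoint pairs {x, x'} among
   them, and form all x + A (A in F) and all {x, x'} + B (B in G). Every member
   meets the n new points, so the core of a k-sunflower contains a new point x,
   and the sets through x consist of a copy of F and possibly a copy of G whose
   members share the point x': a sunflower meeting both copies would give n
   disjoint members of F. By counting new points, n members can only be disjoint
   if they come from n disjoint members of F. Hence one can achieve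
     c_(w+1) = n c_w + m a_(w-1)   and   a_w = c_w + a_(w-1),
   the latter by adding to F a disjoint star over G. The characteristic
   polynomial of this recursion is x^2 - k x + k./2, whose largest root is r_k.
   The families of maximum size exist by the Erdos-Rado lemma, and the limit by
   Fekete's lemma. *)

(** * Sunflower-free families *)

(** A sunflower with core [C] and no prescribed size; for [C = set0] it is a matching. *)
Definition pairwise_inter (T : finType) (C : {set T}) (S : {set {set T}}) : Prop :=
  {in S &, forall A B : {set T}, A != B -> A :&: B = C}.

Definition matching_lt (T : finType) (n : nat) (F : {set {set T}}) : Prop :=
  forall S : {set {set T}}, S \subset F -> pairwise_inter set0 S -> #|S| < n.

Section Pullback.
Variables (T T' : finType) (f : T -> T').
Implicit Types S : {set {set T'}}.

Lemma pairwise_inter_preim (C : {set T'}) S :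
  pairwise_inter C S -> pairwise_inter (f @^-1: C) [set f @^-1: A | A : {set T'} in S].
Proof.
move=> SC _ _ /imsetP[A AS ->] /imsetP[B BS ->] AB.
by rewrite -preimsetI SC//; apply: contraNneq AB => ->.
Qed.

(** Preimages commute with intersections, so a sunflower in [F'] pulls back to one in [F];
    injectivity on [F'] keeps its size. *)
Lemma sunflower_free_preim k (F : {set {set T}}) (F' : {set {set T'}}) :
  {in F', forall A : {set T'}, f @^-1: A \in F} ->
  {in F' &, injective (fun A : {set T'} => f @^-1: A)} ->
  sunflower_free k F -> sunflower_free k F'.
Proof.
move=> F'F inj Ffree S SF' [Sk [C SC]].
apply: (Ffree [set f @^-1: A | A : {set T'} in S]).
  by apply/subsetP=> _ /imsetP[A AS ->]; apply/F'F/(subsetP SF').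
split; last by exists (f @^-1: C); exact: pairwise_inter_preim.
rewrite card_in_imset// => A B AS BS.
by apply: inj; exact: (subsetP SF').
Qed.

End Pullback.

Lemma sunflower_freeS (T : finType) k (F H : {set {set T}}) :
  F \subset H -> sunflower_free k H -> sunflower_free k F.
Proof. by move=> FH Hfree S SF; apply: Hfree; apply: fintype.subset_trans FH. Qed.

Lemma pairwise_interS (T : finType) (C : {set T}) (S S' : {set {set T}}) :
  S \subset S' -> pairwise_inter C S' -> pairwise_inter C S.
Proof. by move=> /subsetP SS' S'C A B AS BS; apply: S'C; exact: SS'. Qed.

(** A sunflower that meets both families has core [C], by intersecting a member of each. As [y] lies
    in every member of [H] but not in [C], only one member comes from [H], and fewer than [k.-1]
    come from [F]. *)
Lemma sunflower_free_setU (T : finType) k (F H : {set {set T}}) (C : {set T}) y :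
  sunflower_free k F -> sunflower_free k H ->
  {in F & H, forall A B : {set T}, A :&: B = C} -> y \notin C ->
  {in H, forall B : {set T}, y \in B} ->
  (forall S : {set {set T}}, S \subset F -> pairwise_inter C S -> #|S| < k.-1) ->
  sunflower_free k (F :|: H).
Proof.
move=> Ffree Hfree FHC yC yH Fk S SFH [Sk [D SD]].
have [SH0|/set0Pn[B /setIP[BS BH]]] := eqVneq (S :&: H) set0.
  apply: (Ffree S); last by split=> //; exists D.
  apply/subsetP=> A AS; move/subsetP: SFH => /(_ _ AS)/setUP[//|AH].
  by move/setP: SH0 => /(_ A); rewrite !inE AS AH.
have [SF0|/set0Pn[A /setIP[AS AF]]] := eqVneq (S :&: F) set0.
  apply: (Hfree S); last by split=> //; exists D.
  apply/subsetP=> A AS; move/subsetP: SFH => /(_ _ AS)/setUP[AF|//].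
  by move/setP: SF0 => /(_ A); rewrite !inE AS AF.
have DC : D = C.
  rewrite -(SD A B)//; first exact: FHC.
  by apply: contraNneq yC => AB; rewrite -(FHC A B)// AB setIid yH.
have SH1 : #|S :&: H| <= 1.
  apply/card_le1_eqP => A1 B1 /setIP[A1S A1H] /setIP[B1S B1H].
  apply/eqP; apply: contraNT yC => AB.
  by rewrite -DC -(SD B1 A1)// ?inE ?yH.
have := Fk (S :&: F) (subsetIr _ _).
rewrite -DC => /(_ (pairwise_interS (subsetIl _ _) SD)).
have : #|S| <= #|S :&: F| + #|S :&: H|.
  rewrite -{1}(setIidPl SFH) setIUr cardsU; exact: leq_subr.
lia.
Qed.

(** Choosing a point of [X] in each member is injective: a point shared by two members would lie in
    [C], which misses [X]. *)
Lemma card_pairwise_inter (T : finType) (C X : {set T}) (S : {set {set T}}) :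
  pairwise_inter C S -> [disjoint C & X] ->
  {in S, forall A : {set T}, A :&: X != set0} -> #|S| <= #|X|.
Proof.
move=> SC CX SX.
have [x0|T0] := pickP (@predT T); last first.
  rewrite [S](_ : _ = set0) ?cards0//; apply/setP=> A; rewrite inE.
  by apply/negP => /SX/set0Pn[x]; have := T0 x.
move=> _; pose p (A : {set T}) := odflt x0 [pick x in A :&: X].
have pP A : A \in S -> p A \in A :&: X.
  move=> AS; rewrite /p; case: pickP => //= A0.
  by have /set0Pn[x] := SX _ AS; rewrite A0.
rewrite -(@card_in_imset _ _ p).
  apply: subset_leq_card; apply/subsetP=> _ /imsetP[A AS ->].
  by have /setIP[] := pP _ AS.
move=> A B AS BS pAB; apply/eqP; apply: contraTT CX => AB.
apply/pred0Pn; exists (p A); rewrite /= -(SC A B)//.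
have /setIP[pA ->] := pP _ AS.
by have /setIP[pB _] := pP _ BS; rewrite inE pA pAB pB.
Qed.

(** Since [X] has fewer than [k] points, the core of a [k]-sunflower cannot miss [X]. It contains
    some [x] in [X], so the whole sunflower lies among the members through [x]. *)
Lemma sunflower_free_cover (T : finType) k (X : {set T}) (F : {set {set T}}) :
  #|X| < k -> 1 < k -> {in F, forall A : {set T}, A :&: X != set0} ->
  {in X, forall x, sunflower_free k [set A in F | x \in A]} ->
  sunflower_free k F.
Proof.
move=> Xk k1 FX Xfree S SF [Sk [C SC]].
have [CX|] := boolP [disjoint C & X].
  have : #|S| <= #|X|.
    by apply: card_pairwise_inter SC CX _ => A /(subsetP SF)/FX.
  by rewrite Sk leqNgt Xk.
case/pred0Pn=> x /andP[/= xC xX].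
apply: (Xfree x xX S); last by split=> //; exists C.
apply/subsetP=> A AS; rewrite inE (subsetP SF)//=.
(* As [1 < k], there is a second member [B], and [A :&: B] is the core, so [x] lies in [A]. *)
have : 0 < #|S :\ A| by rewrite (cardsD1 A) AS in Sk; lia.
case/card_gt0P=> B /setD1P[BA BS].
by move: xC; rewrite -(SC _ _ AS BS) 1?eq_sym// => /setIP[].
Qed.

(** * Sets in a disjoint union of two ground sets *)

Section SumSet.
Variables T U : finType.

Definition sum_set (A : {set T}) (B : {set U}) : {set T + U} :=
  [set z | match z with inl x => x \in A | inr u => u \in B end].

Lemma preim_inl_sum_set A B : inl @^-1: sum_set A B = A.
Proof. by apply/setP => x; rewrite !inE. Qed.

Lemma preim_inr_sum_set A B : inr @^-1: sum_set A B = B.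
Proof. by apply/setP => x; rewrite !inE. Qed.

Lemma card_sum_set A B : #|sum_set A B| = #|A| + #|B|.
Proof.
rewrite -(card_imset (mem A) (@inl_inj T U)) -(card_imset (mem B) (@inr_inj T U)).
rewrite -cardsUI [X in _ + #|pred_of_set X|](_ : _ = set0) ?cards0 ?addn0.
  apply: eq_card => -[x|u]; rewrite !inE.
    rewrite (mem_imset _ _ (@inl_inj T U)).
    by case: (boolP (inl x \in [set inr y | y in mem B])) => [/imsetP[]//|]; rewrite orbF.
  rewrite (mem_imset _ _ (@inr_inj T U)).
  by case: (boolP (inr u \in [set inl y | y in mem A])) => [/imsetP[]//|].
apply/setP => z; rewrite !inE; apply/negP=> /andP[/imsetP[x _ ->]].
by case/imsetP.
Qed.

Lemma sum_setI A A' B B' :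
  sum_set A B :&: sum_set A' B' = sum_set (A :&: A') (B :&: B').
Proof. by apply/setP => -[x|u]; rewrite !inE. Qed.

Lemma sum_set0 : sum_set set0 set0 = set0.
Proof. by apply/setP => -[x|u]; rewrite !inE. Qed.

Lemma sum_set_inj A A' B B' : sum_set A B = sum_set A' B' -> A = A' /\ B = B'.
Proof.
move=> AB; rewrite -(preim_inl_sum_set A B) -{2}(preim_inr_sum_set A B) AB.
by rewrite preim_inl_sum_set preim_inr_sum_set.
Qed.

End SumSet.

(** * Adding a layer of points *)

Section Layer.
Variables (J E T U : finType) (k w : nat).
Variables (F : {set {set T}}) (G : {set {set U}}).
Hypotheses (k1 : 2 < k) (cardX : #|{: J * bool + E}| = k.-1).
Hypotheses (F_unif : uniform w.+1 F) (F_free : sunflower_free k F).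
Hypothesis F_matching : matching_lt k.-1 F.
Hypotheses (G_unif : uniform w G) (G_free : sunflower_free k G).

(** The new points: [(j, false)] and [(j, true)] form the pair indexed by [j], while [E] holds the
    unpaired points. *)
Local Notation X := (J * bool + E)%type.

Definition cone (x : X) (A : {set T}) : {set X + (T + U)} :=
  sum_set [set x] (sum_set A set0).

Definition edge (j : J) (B : {set U}) : {set X + (T + U)} :=
  sum_set [set inl (j, false); inl (j, true)] (sum_set set0 B).

Definition layer : {set {set X + (T + U)}} :=
  [set cone x A | x in setT, A in F] :|: [set edge j B | j in setT, B in G].

Lemma layerP S : S \in layer ->
  (exists x A, A \in F /\ S = cone x A) \/ (exists j B, B \in G /\ S = edge j B).
Proof.
case/setUP => /imset2P[x A _ AF ->]; [left|right]; by exists x, A.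
Qed.

Lemma mem_cone x y A : (inl y \in cone x A) = (y == x).
Proof. by rewrite !inE. Qed.

Lemma mem_edge y j B :
  (inl y \in edge j B) = (y == inl (j, false)) || (y == inl (j, true)).
Proof. by rewrite !inE. Qed.

Lemma edge_mem j b B : inl (inl (j, b)) \in edge j B.
Proof. by rewrite mem_edge; case: b; rewrite eqxx ?orbT. Qed.

Lemma layer_uniform : uniform w.+2 layer.
Proof.
move=> S /layerP[[x [A [AF ->]]]|[j [B [BG ->]]]]; rewrite !card_sum_set cards0.
  by rewrite cards1 (F_unif AF) addn0.
by rewrite cards2 (G_unif BG) (_ : _ != _)//; apply/eqP => -[].
Qed.

Lemma cone_inj x A x' A' : cone x A = cone x' A' -> x = x' /\ A = A'.
Proof. by case/sum_set_inj=> /set1_inj -> /sum_set_inj[->]. Qed.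

Lemma edge_inj j B j' B' : edge j B = edge j' B' -> j = j' /\ B = B'.
Proof.
move=> e; have /sum_set_inj[_ /sum_set_inj[_ ->]] := e; split=> //.
by have := edge_mem j true B; rewrite e mem_edge => /orP[|] /eqP[].
Qed.

Lemma cone_neq_edge x A j B : cone x A <> edge j B.
Proof.
case/sum_set_inj => /setP e _; have := e (inl (j, true)); have := e (inl (j, false)).
by rewrite !inE !eqxx/= orbT => /eqP <- /eqP.
Qed.

Lemma card_layer : #|layer| = k.-1 * #|F| + #|J| * #|G|.
Proof.
rewrite cardsU [X in _ - #|pred_of_set X|](_ : _ = set0) ?cards0 ?subn0.
  rewrite !curry_imset2X !card_in_imset ?cardsX ?cardsT ?cardX//.
    by move=> [j B] [j' B'] _ _ /edge_inj[-> ->].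
  by move=> [x A] [x' A'] _ _ /cone_inj[-> ->].
apply/setP => S; rewrite !inE; apply/negP => /andP[/imset2P[x A _ _ ->]].
by case/imset2P => j B _ _ /cone_neq_edge.
Qed.

Lemma preim_cone x A : (inr \o inl) @^-1: cone x A = A.
Proof. by apply/setP => t; rewrite inE /= !inE. Qed.

Lemma preim_edge j B : (inr \o inr) @^-1: edge j B = B.
Proof. by apply/setP => t; rewrite inE /= !inE. Qed.

Lemma cones_inj x : {in [set cone x A | A in F] &,
  injective (fun S : {set X + (T + U)} => (inr \o inl) @^-1: S)}.
Proof.
by move=> _ _ /imsetP[A _ ->] /imsetP[B _ ->] /=; rewrite !preim_cone => ->.
Qed.

Lemma cones_free x : sunflower_free k [set cone x A | A in F].
Proof.
apply: (@sunflower_free_preim _ _ (inr \o inl)) F_free; last exact: cones_inj.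
by move=> _ /imsetP[A AF ->]; rewrite preim_cone.
Qed.

Lemma edges_free j : sunflower_free k [set edge j B | B in G].
Proof.
apply: (@sunflower_free_preim _ _ (inr \o inr)) G_free.
  by move=> _ /imsetP[A AF ->]; rewrite preim_edge.
by move=> _ _ /imsetP[A _ ->] /imsetP[B _ ->] /=; rewrite !preim_edge => ->.
Qed.

(** Cones that share only their apex restrict on [T] to disjoint members of [F]. *)
Lemma cones_matching x (S : {set {set X + (T + U)}}) :
  S \subset [set cone x A | A in F] -> pairwise_inter [set inl x] S ->
  #|S| < k.-1.
Proof.
move=> SF Sx.
have Sinj : {in S &, injective (fun S : {set X + (T + U)} => (inr \o inl) @^-1: S)}.
  by move=> A B AS BS; apply: (@cones_inj x); exact: (subsetP SF).
rewrite -(card_in_imset Sinj); apply: F_matching.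
  by apply/subsetP=> _ /imsetP[_ /(subsetP SF)/imsetP[A AF ->] ->]; rewrite preim_cone.
have := @pairwise_inter_preim _ _ (inr \o inl) _ _ Sx.
rewrite (_ : _ @^-1: [set inl x] = set0)//.
by apply/setP => t; rewrite inE /= !inE.
Qed.

Definition points : {set X + (T + U)} := inl @: [set: X].

Lemma card_points : #|points| = k.-1.
Proof. by rewrite card_imset ?cardsT ?cardX//; exact: inl_inj. Qed.

Lemma mem_points x : inl x \in points.
Proof. by rewrite imset_f. Qed.

Lemma layer_meets S : S \in layer -> S :&: points != set0.
Proof.
case/layerP=> [[x [A [_ ->]]]|[j [B [_ ->]]]]; apply/set0Pn.
  by exists (inl x); rewrite inE mem_cone eqxx mem_points.
by exists (inl (inl (j, true))); rewrite inE edge_mem mem_points.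
Qed.

(** The new points cover the layer. Through a point of [E] pass only cones; through [(j, b)] pass
    cones with that apex and the edges of [j], and the latter also share the partner [(j, ~~ b)],
    which no cone with apex [(j, b)] contains. *)
Lemma layer_free : sunflower_free k layer.
Proof.
apply: (@sunflower_free_cover _ _ points).
- by rewrite card_points; lia.
- by lia.
- exact: layer_meets.
move=> _ /imsetP[[[j b]|e] _ ->]; last first.
  apply: (@sunflower_freeS _ _ _ [set cone (inr e) A | A in F]); last first.
    exact: cones_free.
  apply/subsetP => S; rewrite inE => /andP[/layerP[[x [A [AF ->]]]|[j [B [_ ->]]]]].
    by rewrite mem_cone => /eqP <-; rewrite imset_f.
  by rewrite mem_edge => /orP[|] /eqP.
apply: (@sunflower_freeS _ _ _
  ([set cone (inl (j, b)) A | A in F] :|: [set edge j B | B in G])).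
  apply/subsetP => S; rewrite inE => /andP[/layerP[[x [A [AF ->]]]|[j' [B [BG ->]]]]].
    by rewrite mem_cone => /eqP <-; rewrite inE imset_f.
  by rewrite mem_edge inE => /orP[|] /eqP[-> _]; rewrite imset_f ?orbT.
apply: (@sunflower_free_setU _ _ _ _ [set inl (inl (j, b))] (inl (inl (j, ~~ b)))).
- exact: cones_free.
- exact: edges_free.
- move=> _ _ /imsetP[A _ ->] /imsetP[B _ ->].
  rewrite !sum_setI setI0 set0I sum_set0; apply/setP => -[x|t].
    rewrite !inE; apply/andP/eqP => [[/eqP -> //]|[->]].
    by rewrite !(inj_eq inl_inj) !xpair_eqE eqxx; case: b.
  by rewrite !inE.
- by rewrite inE; apply/eqP => -[]; case: b.
- by move=> _ /imsetP[B _ ->]; exact: edge_mem.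
- exact: cones_matching.
Qed.

(* A matching that uses an edge has two of its points in the same set, so it is
   already bounded by the number of the remaining points. *)
Lemma layer_matching : matching_lt k.-1 layer.
Proof.
move=> S SL S0.
have [/existsP[j /existsP[B /andP[BG BS]]]|noedge] :=
    boolP [exists j, exists B, (B \in G) && (edge j B \in S)].
  set y := inl (inl (j, true)) : X + (T + U).
  rewrite -card_points (cardsD1 y) mem_points ltnS.
  apply: (card_pairwise_inter S0); first by rewrite disjoints_subset sub0set.
  move=> A AS; have [->|AB] := eqVneq A (edge j B).
    apply/set0Pn; exists (inl (inl (j, false))).
    rewrite inE edge_mem in_setD1 mem_points andbT; by apply/eqP => -[].
  have /set0Pn[z /setIP[zA zP]] := layer_meets (subsetP SL _ AS).
  apply/set0Pn; exists z; rewrite inE zA in_setD1 zP andbT/=.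
  apply: contra_neq AB => zy; apply/eqP; apply/negPn/negP => AB.
  by have /setP/(_ y) := S0 _ _ AS BS AB; rewrite in_setI in_set0 -{1}zy zA edge_mem.
have Scone A : A \in S -> exists x A', A' \in F /\ A = cone x A'.
  move=> AS; have /layerP[//|[j [B [BG AE]]]] := subsetP SL _ AS.
  by case/existsP: noedge; exists j; apply/existsP; exists B; rewrite BG -AE.
pose f : T -> X + (T + U) := inr \o inl.
rewrite -(@card_in_imset _ _ (fun A : {set X + (T + U)} => f @^-1: A)).
  apply: F_matching.
    by apply/subsetP => _ /imsetP[A /Scone[x [A' [A'F ->]]] ->]; rewrite preim_cone.
  by have := @pairwise_inter_preim _ _ f _ _ S0; rewrite preimset0.
(* Distinct members of the matching with the same trace on [T] would have empty trace, but members
   of [F] have [w.+1] elements. *)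
move=> A B AS BS fAB; apply/eqP; apply/negPn/negP => AB.
have fA0 : f @^-1: A = set0.
  by rewrite -(setIid (f @^-1: A)) {2}fAB -preimsetI S0// preimset0.
have [x [A' [A'F AE]]] := Scone A AS.
by have := F_unif A'F; rewrite -(preim_cone x A') -AE fA0 cards0.
Qed.

End Layer.

(** * Stars and products *)

Section StarUnion.
Variables (T U : finType) (k w : nat).
Variables (F : {set {set T}}) (G : {set {set U}}).
Hypotheses (F_unif : uniform w.+1 F) (F_free : sunflower_free k F).
Hypothesis F_matching : matching_lt k.-1 F.
Hypotheses (G_unif : uniform w G) (G_free : sunflower_free k G).

(** The added point [tt] is the centre of the star over [G]. *)
Definition with_star : {set {set T + (unit + U)}} :=
  [set sum_set A set0 | A in F] :|:
  [set sum_set set0 (sum_set [set tt] B) | B in G].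

Lemma with_star_uniform : uniform w.+1 with_star.
Proof.
move=> _ /setUP[] /imsetP[A AF ->]; rewrite !card_sum_set cards0.
  by rewrite (F_unif AF) addn0.
by rewrite cards1 (G_unif AF).
Qed.

Lemma card_with_star : #|with_star| = #|F| + #|G|.
Proof.
rewrite cardsU [X in _ - #|pred_of_set X|](_ : _ = set0) ?cards0 ?subn0.
  rewrite !card_imset// => [A B /sum_set_inj[_ /sum_set_inj[]]//|A B].
  by case/sum_set_inj.
apply/setP => S; rewrite !inE; apply/negP => /andP[/imsetP[A _ ->] /imsetP[B _]].
by move=> /sum_set_inj[_ /setP/(_ (inl tt))]; rewrite !inE.
Qed.

(** The copy of [F] and the star live on disjoint ground sets, so a sunflower meeting both has empty
    core; at most one member contains [tt], and the others form a matching in [F]. *)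
Lemma with_star_free : sunflower_free k with_star.
Proof.
have Finj : {in [set sum_set A set0 | A in F] &,
    injective (fun S : {set T + (unit + U)} => inl @^-1: S)}.
  by move=> _ _ /imsetP[A _ ->] /imsetP[B _ ->] /=; rewrite !preim_inl_sum_set => ->.
apply: (@sunflower_free_setU _ _ _ _ set0 (inr (inl tt))).
- apply: sunflower_free_preim Finj F_free.
  by move=> _ /imsetP[A AF ->]; rewrite preim_inl_sum_set.
- apply: (@sunflower_free_preim _ _ (fun u => inr (inr u))) G_free.
    move=> _ /imsetP[A AG ->]; rewrite (_ : _ @^-1: _ = A)//.
    by apply/setP => u; rewrite !inE.
  move=> _ _ /imsetP[A _ ->] /imsetP[B _ ->] /setP AB.
  suff -> : A = B by [].
  by apply/setP => u; have := AB u; rewrite !inE.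
- move=> _ _ /imsetP[A _ ->] /imsetP[B _ ->].
  by rewrite sum_setI setI0 set0I sum_set0.
- by rewrite inE.
- by move=> _ /imsetP[B _ ->]; rewrite !inE.
- move=> S SF S0.
  have Sinj : {in S &, injective (fun S : {set T + (unit + U)} => inl @^-1: S)}.
    by move=> A B AS BS; apply: Finj; exact: (subsetP SF).
  rewrite -(card_in_imset Sinj); apply: F_matching.
    apply/subsetP=> _ /imsetP[_ /(subsetP SF)/imsetP[A AF ->] ->].
    by rewrite preim_inl_sum_set.
  by have := @pairwise_inter_preim _ _ inl _ _ S0; rewrite preimset0.
Qed.

End StarUnion.

Section Product.
Variables (T U : finType) (k u v : nat).
Variables (F : {set {set T}}) (G : {set {set U}}).
Hypotheses (F_unif : uniform u F) (F_free : sunflower_free k F).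
Hypotheses (G_unif : uniform v G) (G_free : sunflower_free k G).

Definition prod_family : {set {set T + U}} := [set sum_set A B | A in F, B in G].

Lemma prod_family_uniform : uniform (u + v) prod_family.
Proof.
by move=> _ /imset2P[A B AF BG ->]; rewrite card_sum_set (F_unif AF) (G_unif BG).
Qed.

Lemma card_prod_family : #|prod_family| = #|F| * #|G|.
Proof.
rewrite /prod_family curry_imset2X card_in_imset ?cardsX//.
by move=> [A B] [A' B'] _ _ /sum_set_inj[-> ->].
Qed.

(* If two members of a sunflower agree on the left ground set, then the left
   part of the core is a whole member of F, so all of them agree there. *)
Lemma prod_family_free : sunflower_free k prod_family.
Proof.
move=> S SFG [Sk [C SC]].
pose l (A : {set T + U}) : {set T} := inl @^-1: A.
pose r (A : {set T + U}) : {set U} := inr @^-1: A.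
have lF A : A \in S -> l A \in F.
  by move=> /(subsetP SFG)/imset2P[A1 A2 A1F _ ->]; rewrite /l preim_inl_sum_set.
have rG A : A \in S -> r A \in G.
  by move=> /(subsetP SFG)/imset2P[A1 A2 _ A2G ->]; rewrite /r preim_inr_sum_set.
have lr A B : l A = l B -> r A = r B -> A = B.
  move=> /setP lAB /setP rAB; apply/setP => -[x|x].
    by have := lAB x; rewrite !inE.
  by have := rAB x; rewrite !inE.
have [linj|] := boolP [forall A in S, forall B in S, (l A == l B) ==> (A == B)].
  apply: (F_free (S := l @: S)).
    by apply/subsetP=> _ /imsetP[A AS ->]; exact: lF.
  split; last by exists (l C); exact: pairwise_inter_preim.
  rewrite card_in_imset// => A B AS BS AB; apply/eqP.
  have /forall_inP/(_ _ AS)/forall_inP/(_ _ BS)/implyP := linj.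
  by apply; apply/eqP.
case/forall_inPn => A AS /forall_inPn[B BS]; rewrite negb_imply => /andP[/eqP lAB AB].
have lC : l C = l A by rewrite -(SC _ _ AS BS AB) /l preimsetI -/(l B) -lAB setIid.
have lS D : D \in S -> l D = l A.
  move=> DS; apply/eqP; have [->//|DA] := eqVneq D A.
  rewrite eq_sym eqEcard (F_unif (lF _ AS)) (F_unif (lF _ DS)) leqnn andbT.
  by rewrite -lC -(SC _ _ DS AS DA) /l preimsetI subsetIl.
apply: (G_free (S := r @: S)).
  by apply/subsetP=> _ /imsetP[D DS ->]; exact: rG.
split; last by exists (r C); exact: pairwise_inter_preim.
by rewrite card_in_imset// => D D' DS D'S; apply: lr; rewrite !lS.
Qed.

End Product.

(** * The Erdos-Rado bound and the existence of the maximum *)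

Lemma sunflower_free_link (T : finType) k (x : T) (F : {set {set T}}) :
  sunflower_free k F ->
  sunflower_free k [set A :\ x | A in [set A in F | x \in A]].
Proof.
move=> Ffree S SF [Sk [C SC]].
have SP A : A \in S -> x |: A \in F /\ x \notin A.
  move=> /(subsetP SF)/imsetP[B]; rewrite inE => /andP[BF xB] ->.
  by rewrite setD1K// setD11.
apply: (Ffree [set x |: A | A in S]).
  by apply/subsetP => _ /imsetP[A /SP[xA _] ->].
split.
  rewrite card_in_imset// => A B AS BS /setP AB; apply/setP => y.
  have [->|yx] := eqVneq y x.
    by rewrite (negbTE (SP _ AS).2) (negbTE (SP _ BS).2).
  by have := AB y; rewrite !inE (negbTE yx).
exists (x |: C) => _ _ /imsetP[A AS ->] /imsetP[B BS ->] AB.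
by rewrite -setUIr (SC A B)//; apply: contraNneq AB => ->.
Qed.

Lemma card_trivIset_sunflower_free (T : finType) k (F S : {set {set T}}) :
  sunflower_free k F -> S \subset F -> trivIset S -> #|S| < k.
Proof.
move=> Ffree SF /trivIsetP Striv; rewrite ltnNge; apply/negP => kS.
have : 0 < #|[set D : {set {set T}} | D \subset S & #|D| == k]|.
  by rewrite cards_draws bin_gt0.
case/card_gt0P => D; rewrite inE => /andP[DS /eqP Dk].
apply: (Ffree D); first exact: fintype.subset_trans SF.
split=> //; exists set0 => A B AD BD AB; apply/eqP.
by rewrite setI_eq0; apply: Striv AB; exact: (subsetP DS).
Qed.

(** Induction on [w]. A maximal disjoint subfamily [S] has fewer than [k] members, hence at most
    [k * w.+1] points in its union. Every member of [F] meets this union, and the members through a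
    given point are bounded by [N] after deleting that point. *)
Lemma erdos_rado_bound (w k : nat) :
  exists N, forall (T : finType) (F : {set {set T}}),
    uniform w F -> sunflower_free k F -> #|F| <= N.
Proof.
elim: w => [|w [N IH]].
  exists 1 => T F F0 _; apply: leq_trans (_ : #|[set set0 : {set T}]| <= 1).
    apply/subset_leq_card/subsetP => A AF.
    by rewrite inE -cards_eq0 (F0 _ AF).
  by rewrite cards1.
exists (k * w.+1 * N) => T F Funif Ffree.
have : exists S : {set {set T}}, (S \subset F) && trivIset S.
  by exists set0; rewrite sub0set; apply/trivIsetP => A B; rewrite inE.
case/ex_maxset => S /maxsetP[/andP[SF Striv] Smax].
have Sk : #|S| < k by exact: card_trivIset_sunflower_free SF Striv.
have coverS : #|cover S| <= k * w.+1.
  apply: leq_trans (leq_card_cover S) _.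
  rewrite (eq_bigr (fun=> w.+1)) => [|A /(subsetP SF)/Funif//].
  by rewrite sum_nat_const leq_mul2r ltnW ?orbT.
have Fcover : F \subset \bigcup_(x in cover S) [set A in F | x \in A].
  apply/subsetP => A AF.
  have A0 : A != set0 by rewrite -cards_eq0 (Funif _ AF).
  have : ~~ [disjoint A & cover S].
    (* A member disjoint from [cover S] could be added to [S], against maximality. *)
    apply: contraL A0 => Adisj; rewrite negbK.
    have AS : {in S, forall B : {set T}, [disjoint A & B]}.
      move=> B BS; apply: disjointWr Adisj; exact: bigcup_sup.
    have S0 : set0 \notin S.
      by apply/negP => /(subsetP SF)/Funif; rewrite cards0.
    have [AStriv AnS] := trivIsetU1 AS Striv S0.
    have := Smax (A |: S); rewrite subUset sub1set AF SF AStriv subsetU1.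
    by move=> /(_ isT isT) ASS; rewrite -ASS setU11 in AnS.
  case/pred0Pn => x /andP[/= xA xS].
  by apply/bigcupP; exists x => //; rewrite inE AF.
apply: leq_trans (subset_leq_card Fcover) _.
apply: (@leq_trans (#|cover S| * N)); last by rewrite leq_mul2r coverS orbT.
rewrite -sum_nat_const; apply: (big_ind2 (fun (A : {set {set T}}) n => #|A| <= n)) => [|A m B n Am Bn|x _].
- by rewrite cards0.
- by apply: leq_trans (leq_add Am Bn); rewrite cardsU leq_subr.
rewrite -(@card_in_imset _ _ (fun A => A :\ x)).
  apply: IH (sunflower_free_link (x := x) Ffree).
  move=> B /imsetP[A]; rewrite inE => /andP[AF xA] ->.
  by have := Funif _ AF; rewrite (cardsD1 x) xA => -[].
move=> A B; rewrite !inE => /andP[_ xA] /andP[_ xB] AB.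
by rewrite -(setD1K xA) AB setD1K.
Qed.

(** The attained sizes are bounded and include 0, so [xget] returns a true maximum rather than its
    default. *)
Lemma max_sunflower_freeP (w k : nat) : 0 < k ->
  sunflower_free_size w k (max_sunflower_free w k) /\
  forall n, sunflower_free_size w k n -> n <= max_sunflower_free w k.
Proof.
move=> k0.
have [N wN] := erdos_rado_bound w k.
have ex : exists n, `[< sunflower_free_size w k n >].
  (* The empty family works because [0 < k]: for [k = 0] the empty collection is itself a
     sunflower. *)
  exists 0; apply/asboolP; exists void, set0; split; rewrite ?cards0//.
    by move=> A; rewrite inE.
  move=> S; rewrite subset0 => /eqP -> [+ _].
  by rewrite cards0 => k0'; rewrite -k0' in k0.
have ub n : `[< sunflower_free_size w k n >] -> n <= N.
  by move=> /asboolP[T [F [Fu Ff <-]]]; exact: wN.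
apply: (@xgetPex _ 0%N [set m : nat | sunflower_free_size w k m /\
    forall n : nat, sunflower_free_size w k n -> (n <= m)%N]%classic).
have [m /asboolP mP mmax] := ex_maxnP ex ub.
by exists m; split=> // n nP; apply: mmax; exact/asboolP.
Qed.

(** * The recursion for the sizes *)

Definition matching_free_size (w k m : nat) : Prop :=
  exists (T : finType) (F : {set {set T}}),
    [/\ uniform w F, sunflower_free k F, matching_lt k.-1 F & #|F| = m].

Lemma layer_size k w a c : 2 < k ->
  matching_free_size w.+1 k c -> sunflower_free_size w k a ->
  matching_free_size w.+2 k (k.-1 * c + k.-1./2 * a).
Proof.
move=> k2 [T [F [Fu Ff Fm <-]]] [U [G [Gu Gf <-]]].
(* As many pairs as fit into [k.-1] points, with one point left over when [k.-1] is odd. *)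
have cardX : #|{: 'I_(k.-1./2) * bool + 'I_(odd k.-1)}| = k.-1.
  by rewrite card_sum card_prod !card_ord card_bool; lia.
exists _, (layer 'I_(k.-1./2) 'I_(odd k.-1) F G).
split.
- exact: layer_uniform.
- exact: (layer_free k2 cardX).
- exact: (layer_matching cardX Fu Fm).
- by rewrite (card_layer _ _ cardX) card_ord.
Qed.

Lemma with_star_size k w a c :
  matching_free_size w.+1 k c -> sunflower_free_size w k a ->
  sunflower_free_size w.+1 k (c + a).
Proof.
move=> [T [F [Fu Ff Fm <-]]] [U [G [Gu Gf <-]]].
exists _, (with_star F G); split.
- exact: with_star_uniform.
- exact: with_star_free.
- exact: card_with_star.
Qed.

Lemma sunflower_free_size_mul k u v m n :
  sunflower_free_size u k m -> sunflower_free_size v k n ->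
  sunflower_free_size (u + v) k (m * n).
Proof.
move=> [T [F [Fu Ff <-]]] [U [G [Gu Gf <-]]].
exists _, (prod_family F G); split.
- exact: prod_family_uniform.
- exact: (prod_family_free Fu).
- exact: card_prod_family.
Qed.

Lemma sunflower_free_size0 k : 1 < k -> sunflower_free_size 0 k 1.
Proof.
move=> k1; exists void, [set set0]; split; rewrite ?cards1//.
  by move=> A; rewrite inE => /eqP ->; rewrite cards0.
by move=> S /subset_leq_card; rewrite cards1 => S1 [Sk _]; lia.
Qed.

(** A family of [k.-2] singletons has too few members to contain [k.-1] disjoint sets or a
    [k]-sunflower. *)
Lemma matching_free_size1 k : 1 < k -> matching_free_size 1 k k.-2.
Proof.
move=> k1; exists 'I_(k.-2), [set [set x] | x in setT].
have cardF : #|[set [set x] | x in [set: 'I_(k.-2)]]| = k.-2.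
  by rewrite card_imset ?cardsT ?card_ord//; exact: set1_inj.
split=> //.
- by move=> _ /imsetP[x _ ->]; rewrite cards1.
- by move=> S /subset_leq_card; rewrite cardF => Sk [SE _]; lia.
- by move=> S /subset_leq_card; rewrite cardF => Sk _; lia.
Qed.

(* The components are the sizes of a w-uniform and of a (w+1)-uniform family. *)
Fixpoint sizes (k w : nat) : nat * nat :=
  if w is w'.+1 then
    let: (a, c) := sizes k w' in (c + a, k.-1 * c + k.-1./2 * a)
  else (1, k.-2).

Lemma sizesP k w : 2 < k ->
  sunflower_free_size w k (sizes k w).1 /\ matching_free_size w.+1 k (sizes k w).2.
Proof.
move=> k2; elim: w => [|w [aP cP]] /=.
  by split; [apply: sunflower_free_size0 | apply: matching_free_size1]; lia.
case: (sizes k w) aP cP => a c /= aP cP.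
by split; [exact: with_star_size | exact: layer_size].
Qed.

Lemma max_sunflower_free_mul k u v : 0 < k ->
  max_sunflower_free u k * max_sunflower_free v k <= max_sunflower_free (u + v) k.
Proof.
move=> k0; apply: (max_sunflower_freeP (u + v) k0).2.
by apply: sunflower_free_size_mul; exact: (max_sunflower_freeP _ k0).1.
Qed.

Lemma sizes_le_max k w : 2 < k -> (sizes k w).1 <= max_sunflower_free w k.
Proof.
move=> k2; have k0 : 0 < k by lia.
exact/(max_sunflower_freeP w k0).2/(sizesP w k2).1.
Qed.

(** * Growth rate *)

Import Order.TTheory GRing.Theory Num.Theory.
Import numFieldNormedType.Exports.

Local Open Scope classical_set_scope.
Local Open Scope ring_scope.

Section GrowthBound.
Variables (R : realType) (k : nat).
Hypothesis k2 : (2 < k)%N.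
Local Notation r := (growth_bound R k).

(** The discriminant [k^2 - 4 * k./2] equals [k^2 - 2k] for even [k] and [k^2 - 2k + 2] for odd [k],
    so one equation covers both cases. *)
Lemma growth_bound_sqr : r ^+ 2 = k%:R * r - (k./2)%:R.
Proof.
have k3 : 3 <= k%:R :> R by rewrite ler_nat.
have kE : k%:R = (odd k)%:R + (k./2)%:R * 2 :> R.
  by rewrite -natrM -natrD muln2 odd_double_half.
rewrite /growth_bound; case: (odd k) kE => /= kE.
  have /sqr_sqrtr : 0 <= k%:R ^+ 2 - 2 * k%:R + 2 :> R by nra.
  by move: (Num.sqrt _) => s sE; nra.
have /sqr_sqrtr : 0 <= k%:R ^+ 2 - 2 * k%:R :> R by nra.
by move: (Num.sqrt _) => s sE; nra.
Qed.

Lemma growth_bound_itv : k%:R / 2 <= r <= k%:R.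
Proof.
have k3 : 3 <= k%:R :> R by rewrite ler_nat.
rewrite /growth_bound; case: (odd k).
  have /sqr_sqrtr : 0 <= k%:R ^+ 2 - 2 * k%:R + 2 :> R by nra.
  move: (Num.sqrt _) (sqrtr_ge0 (k%:R ^+ 2 - 2 * k%:R + 2 : R)) => s s0 sE.
  by apply/andP; split; nra.
have /sqr_sqrtr : 0 <= k%:R ^+ 2 - 2 * k%:R :> R by nra.
move: (Num.sqrt _) (sqrtr_ge0 (k%:R ^+ 2 - 2 * k%:R : R)) => s s0 sE.
by apply/andP; split; nra.
Qed.

(* (1, r - 1) is an eigenvector, with eigenvalue r, of the linear recursion
   that defines [sizes]. *)
Lemma sizes_ge w :
  r ^+ w / 2 <= (sizes k w).1%:R /\ (r - 1) * r ^+ w / 2 <= (sizes k w).2%:R.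
Proof.
have [/andP[r_ge r_le] r2] := (growth_bound_itv, growth_bound_sqr).
have k3 : 3 <= k%:R :> R by rewrite ler_nat.
(* The factor 1/2 is for the base case: [r <= k] and [3 <= k] give [(r - 1) / 2 <= k - 2]. *)
elim: w => [|w] /=.
  rewrite expr0 -subn2 natrB; last by lia.
  by split; lra.
case: (sizes k w) => a c /= [IHa IHc].
have rw : 0 <= r ^+ w by apply: exprn_ge0; lra.
split; first by rewrite natrD exprS; nra.
have kE : (k = k.-1./2 + k./2 + 1)%N by lia.
rewrite [X in (X * c)%N](_ : k.-1 = k.-1./2 + k./2)%N; last by lia.
rewrite natrD !natrM natrD.
have : k%:R = (k.-1./2)%:R + (k./2)%:R + 1 :> R by rewrite {1}kE !natrD.
move: (ler0n R k.-1./2) (ler0n R k./2) => m0 h0 kER.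
(* With [m = k.-1./2] and [h = k./2], so that [k - 1 = m + h], the equation for [r] reads
   [r^2 - r = (m + h) * (r - 1) + m]. *)
rewrite (_ : _ * _ / 2 = ((k.-1./2)%:R + (k./2)%:R) * ((r - 1) * r ^+ w / 2)
   + (k.-1./2)%:R * (r ^+ w / 2)).
  by rewrite lerD// ler_wpM2l// addr_ge0.
transitivity ((r ^+ 2 - r) * r ^+ w / 2); first by rewrite exprS; ring.
by rewrite r2 kER; field.
Qed.

End GrowthBound.

(** * Limits of roots and Fekete's lemma *)

Lemma invn_cvg0 (R : realType) : (fun n : nat => n%:R^-1 : R) @ \oo --> (0 : R).
Proof. by rewrite -cvg_shiftS; exact: cvg_harmonic. Qed.

Lemma cvg_powR_exponent (R : realType) (y a : R) (u : nat -> R) : 0 < y ->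
  u @ \oo --> a -> (fun n => y `^ u n) @ \oo --> y `^ a.
Proof.
move=> y0 ua; rewrite /powR gt_eqF//.
apply: (@continuous_cvg _ _ _ _ _ _ expR); first exact: continuous_expR.
by apply: cvgM => //; exact: cvg_cst.
Qed.

(** Any [M] below the supremum is below some term, hence eventually a lower bound of the sequence.
    The supremum may be infinite; it is not [-oo] since the terms are real. *)
Lemma EFin_cvg_sup (R : realType) (u : nat -> R) :
  (forall m M, M < u m -> \forall n \near \oo, M <= u n) ->
  (fun n => (u n)%:E) @ \oo --> ereal_sup (range (fun n => (u n)%:E)).
Proof.
move=> um; set s := ereal_sup _.
have us n : ((u n)%:E <= s)%E by apply: ereal_sup_ubound; exists n.
have su M : (M%:E < s)%E -> \forall n \near \oo, M <= u n.
  by case/ereal_sup_gt => _ [m _ <-]; rewrite lte_fin; exact: um.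
case: s us su => [s| |] us su.
- apply/cvg_EFin; first by near=> n.
  apply/cvgrPdist_le => e e0; near=> n.
  have := us n; rewrite lee_fin => uns.
  rewrite ger0_norm ?subr_ge0// lerBlDr -lerBlDl.
  by near: n; apply: su; rewrite lte_fin ltrBlDr ltrDl.
- apply/cvgeyPge => M; near=> n; rewrite lee_fin.
  by near: n; apply: su; rewrite ltry.
- by have := us 0%N; rewrite leeNy_eq.
Unshelve. all: by end_near. Qed.

(** Fix [b > 0] and let [q = n %/ b]. Then [f n >= f b ^ q], the remainder contributing a factor at
    least 1, and [q / n >= 1 / b - 1 / n]. So the n-th root is at least [f b] to the power
    [1 / b - 1 / n], which tends to the b-th root of [f b]. *)
Lemma fekete_supermultiplicative (R : realType) (f : nat -> R) :
  (forall n, 1 <= f n) -> (forall m n, f m * f n <= f (m + n)%N) ->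
  cvgn (fun n => (f n `^ n%:R^-1)%:E).
Proof.
move=> f1 fM; have f0 n : 0 < f n by exact: lt_le_trans (f1 n).
apply/cvg_ex; eexists; apply: EFin_cvg_sup => b M Mb.
have powR_ge1 n : 1 <= f n `^ n%:R^-1.
  by rewrite -[leLHS](powRr0 (f n)) ler_powR// invr_ge0.
(* The term of index 0 is 1, as [0^-1 = 0], and no term is smaller. *)
case: b Mb => [|b] Mb.
  near=> n; apply: le_trans (powR_ge1 n); apply: ltW.
  by rewrite invr0 powRr0 in Mb.
have fX q : f b.+1 ^+ q <= f (q * b.+1)%N.
  elim: q => [|q IH]; first by rewrite expr0 f1.
  rewrite exprS mulSn; apply: le_trans (fM _ _).
  by rewrite ler_wpM2l// ltW.
have lb n : (0 < n)%N -> f b.+1 `^ (b.+1%:R^-1 - n%:R^-1) <= f n `^ n%:R^-1.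
  move=> n0; have n0R : 0 < n%:R :> R by rewrite ltr0n.
  apply: (@le_trans _ _ ((f b.+1 ^+ (n %/ b.+1)) `^ n%:R^-1)); last first.
    rewrite ge0_ler_powR ?nnegrE ?invr_ge0 ?exprn_ge0 ?(ltW (f0 _))//.
    rewrite [X in _ <= f X](divn_eq n b.+1).
    apply: le_trans (fX _) _; apply: le_trans (fM _ _).
    by rewrite ler_peMr// ltW.
  rewrite -powR_mulrn ?(ltW (f0 _))// -powRrM ler_powR//.
  have : n%:R <= ((n %/ b.+1)%:R + 1) * b.+1%:R :> R.
    rewrite natr1 -natrM ler_nat.
    by rewrite {1}(divn_eq n b.+1) mulSn addnC leq_add2r ltnW// ltn_mod.
  have b0 : 0 < b.+1%:R :> R by rewrite ltr0n.
  move: b.+1%:R b0 => B B0 nB.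
  rewrite -(ler_pM2r n0R) mulrBl mulVf ?gt_eqF// -mulrA mulVf ?gt_eqF// mulr1.
  by rewrite lerBlDr mulrC ler_pdivrMr.
have cvg : (fun n => f b.+1 `^ (b.+1%:R^-1 - n%:R^-1)) @ \oo --> f b.+1 `^ b.+1%:R^-1.
  apply: cvg_powR_exponent => //; rewrite -[X in _ --> X]subr0.
  by apply: cvgB; [exact: cvg_cst|exact: invn_cvg0].
near=> n; apply: le_trans (lb n _); last by near: n; exact: nbhs_infty_gt.
by near: n; apply: (cvgr_ge _ cvg).
Unshelve. all: by end_near. Qed.

Theorem theorem3p5 (R : realType) (k : nat) (hk : (3 <= k)%N) :
  ((growth_bound R k)%:E <= sunflower_growth R k)%E.
Proof.
have k0 : (0 < k)%N by lia.
have /andP[r_ge r_le] := growth_bound_itv R hk.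
have r0 : 0 < growth_bound R k.
  by apply: lt_le_trans r_ge; rewrite divr_gt0// ltr0n.
pose f w : R := (max_sunflower_free w k)%:R.
have f_ge w : growth_bound R k ^+ w / 2 <= f w.
  by apply: le_trans (sizes_ge R hk w).1 _; rewrite ler_nat sizes_le_max.
have f1 w : 1 <= f w.
  rewrite -[1]/(1%:R) ler_nat; apply: leq_trans (sizes_le_max w hk).
  (* A natural number that is at least [r ^ w / 2 > 0] is at least 1. *)
  rewrite -(ltr0n R); apply: lt_le_trans (sizes_ge R hk w).1.
  by rewrite divr_gt0// exprn_gt0.
have fM u v : f u * f v <= f (u + v)%N.
  by rewrite -natrM ler_nat max_sunflower_free_mul.
(* For [w > 0] this is the w-th root of the lower bound [r ^ w / 2]; the constant 1/2 disappears in
   the limit. *)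
pose g (w : nat) : R := 2^-1 `^ w%:R^-1 * growth_bound R k.
have g_cvg : (fun w => (g w)%:E) @ \oo --> (growth_bound R k)%:E.
  apply/cvg_EFin; first by near=> n.
  rewrite -[X in _ --> X]mul1r -(powRr0 2^-1); apply: cvgM; last exact: cvg_cst.
  by apply: cvg_powR_exponent; [rewrite invr_gt0|exact: invn_cvg0].
rewrite -(cvg_lim _ g_cvg)//; apply: lee_lim.
- by apply/cvg_ex; eexists; exact: g_cvg.
- exact: (fekete_supermultiplicative f1 fM).
near=> w; have w0 : (0 < w)%N by near: w; exact: nbhs_infty_gt.
rewrite lee_fin.
have -> : g w = (growth_bound R k ^+ w / 2) `^ w%:R^-1.
  rewrite powRM ?exprn_ge0 ?ltW// mulrC -powR_mulrn ?ltW// -powRrM.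
  by rewrite mulfV ?powRr1 ?ltW// pnatr_eq0 -lt0n.
rewrite ge0_ler_powR ?nnegrE ?invr_ge0 ?divr_ge0 ?exprn_ge0 ?ler0n ?(ltW r0)//.
Unshelve. all: by end_near. Qed.
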